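(* For all integers $n\ge 0$, $$c(f^{(3)};n)\equiv p(n) \pmod 4\qquad\text{and}\qquad c(\phi^{(3)};n)\equiv p(n)\pmod 2 .$$
   Context: $p(n)$ is the number of partitions of $n$ (with $p(0)=1$). $(a;q)_n=\prod_{k=0}^{n-1}(1-aq^k)$. For a formal power series $g(q)=\sum_{n\ge0}c(n)q^n$, $c(g;n):=c(n)$. The third order mock theta functions are $$f^{(3)}(q)=\sum_{n=0}^\infty\frac{q^{n^2}}{(-q;q)_n^2},\qquad \phi^{(3)}(q)=\sum_{n=0}^\infty\frac{q^{n^2}}{(-q^2;q^2)_n}.$$ *)

(* Defs.v *)
From mathcomp Require Import all_boot all_order all_algebra.

Set Implicit Arguments.
Unset Strict Implicit.
Unset Printing Implicit Defensive.

Import GRing.Theory.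
Local Open Scope ring_scope.

(* A partition of n is a weakly decreasing sequence of positive integers with
   sum n; its length and its parts are at most n, so it lives in a finType. *)
Definition is_partition (n : nat) (s : seq nat) : bool :=
  [&& sorted geq s, 0%N \notin s & sumn s == n].

Definition npart (n : nat) : nat :=
  #|[set s : {bseq n of 'I_n.+1} | is_partition n (map val s)]|.

Lemma is_partition_bseq (n : nat) (s : seq nat) :
  is_partition n s -> exists t : {bseq n of 'I_n.+1}, map val t = s.
Proof.
case/and3P=> _ s0 /eqP sn.
have szle : (size s <= n)%N.
  rewrite -{}sn; elim: s s0 => //= x s IH; rewrite inE negb_or => /andP[x0 s0].
  by rewrite -add1n leq_add ?IH // lt0n eq_sym.
have le_s x : x \in s -> (x <= n)%N.
  by move=> xs; rewrite -sn sumnE (big_rem x xs) leq_addr.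
have sz : (size (map (@inord n) s) <= n)%N by rewrite size_map.
exists (Bseq sz); rewrite /= -map_comp -[RHS]map_id.
by apply/eq_in_map => x /le_s xn /=; rewrite inordK.
Qed.

(* A formal power series over the integers is its sequence of coefficients:
   g n is the coefficient c(g; n). *)
Definition fps := nat -> int.

Definition qpoch (R : comNzRingType) (a q : R) (n : nat) : R :=
  \prod_(k < n) (1 - a * q ^+ k).

(* The power series p / d, for d with constant coefficient 1, by the geometric
   expansion 1 / d = \sum_k (1 - d)^k; since (1 - d)^k is divisible by 'X^k,
   only the terms k <= n reach the coefficient of 'X^n. *)
Definition fps_frac (p d : {poly int}) : fps :=
  fun n => (p * \sum_(k < n.+1) (1 - d) ^+ k)`_n.

(* The sum of a family of power series such that F m is divisible by 'X^m:
   the terms m > n do not contribute to the coefficient of 'X^n. *)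
Definition fps_sum (F : nat -> fps) : fps :=
  fun n => \sum_(m < n.+1) F m n.

Definition f3_term (m : nat) : fps :=
  fps_frac 'X^(m ^ 2) (qpoch (- 'X) 'X m ^+ 2).

Definition phi3_term (m : nat) : fps :=
  fps_frac 'X^(m ^ 2) (qpoch (- 'X^2) 'X^2 m).

Definition f3 : fps := fps_sum f3_term.

Definition phi3 : fps := fps_sum phi3_term.

Lemma coef_geo_small (d p : {poly int}) (k n : nat) :
  d`_0 = 1 -> (n < k)%N -> (p * (1 - d) ^+ k)`_n = 0.
Proof.
move=> d0 nk; have /factor_theorem[e ->] : root (1 - d) 0.
  by rewrite /root hornerD hornerN hornerC horner_coef0 d0 subrr.
by rewrite subr0 exprMn_comm; [rewrite mulrA coefMXn nk | apply: mulrC].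
Qed.

Lemma fps_fracE (p d : {poly int}) (n N : nat) :
  d`_0 = 1 -> (n < N)%N ->
  fps_frac p d n = (p * \sum_(k < N) (1 - d) ^+ k)`_n.
Proof.
move=> d0 /subnKC <-; rewrite /fps_frac big_split_ord /= mulrDr coefD.
rewrite [X in _ = _ + X](_ : _ = 0) ?addr0 // mulr_sumr coef_sum big1 // => i _.
by apply: coef_geo_small => //; rewrite leq_addr.
Qed.

(* The product of d and fps_frac p d is p. *)
Lemma mul_fps_frac (p d : {poly int}) (n : nat) :
  d`_0 = 1 -> \sum_(i < n.+1) d`_i * fps_frac p d (n - i)%N = p`_n.
Proof.
move=> d0; under eq_bigr => i _ do
  rewrite (fps_fracE p d0 (N := n.+1)) ?ltnS ?leq_subr //.
rewrite -coefM mulrCA -{1}[d](subKr 1) -opprB mulNr -subrX1 opprB mulrBr mulr1.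
by rewrite coefB coef_geo_small ?subr0.
Qed.

Lemma fps_frac_small (d : {poly int}) (k n : nat) :
  (n < k)%N -> fps_frac 'X^k d n = 0.
Proof. by move=> nk; rewrite /fps_frac coefXnM nk. Qed.

Lemma fps_sumE (F : nat -> fps) (n N : nat) :
  (forall m, (n < m)%N -> F m n = 0) -> (n < N)%N ->
  fps_sum F n = \sum_(m < N) F m n.
Proof.
move=> F0 /subnKC <-; rewrite /fps_sum big_split_ord /=.
by rewrite [X in _ = _ + X]big1 ?addr0 // => i _; rewrite F0 // leq_addr.
Qed.

Lemma f3_term_small (m n : nat) : (n < m)%N -> f3_term m n = 0.
Proof.
by move=> nm; apply/fps_frac_small/(leq_trans nm); case: m {nm} => // m;
  rewrite -mulnn leq_pmulr.
Qed.

Lemma phi3_term_small (m n : nat) : (n < m)%N -> phi3_term m n = 0.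
Proof.
by move=> nm; apply/fps_frac_small/(leq_trans nm); case: m {nm} => // m;
  rewrite -mulnn leq_pmulr.
Qed.

Lemma qpoch_coef0 (a q : {poly int}) (n : nat) :
  a`_0 = 0 -> (qpoch a q n)`_0 = 1.
Proof.
move=> a0; rewrite -horner_coef0 horner_prod big1 // => k _.
by rewrite hornerD hornerN hornerM horner_coef0 [a.[0]]horner_coef0 a0 mul0r
  oppr0 addr0 coefC.
Qed.

Lemma f3_denom_coef0 (m : nat) : (qpoch (- 'X) 'X m ^+ 2 : {poly int})`_0 = 1.
Proof.
by rewrite expr2 coef0M (@qpoch_coef0 (- 'X)) ?mulr1 // coefN coefX oppr0.
Qed.

Lemma phi3_denom_coef0 (m : nat) : (qpoch (- 'X^2) 'X^2 m : {poly int})`_0 = 1.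
Proof. by rewrite (@qpoch_coef0 (- 'X^2)) // coefN coefXn oppr0. Qed.

(* Main.v *)
Require Import Defs.
From HB Require Import structures.
From mathcomp Require Import all_boot all_order all_algebra.
From mathcomp Require Import zify ring.

Set Implicit Arguments.
Unset Strict Implicit.
Unset Printing Implicit Defensive.
Import GRing.Theory.
Local Open Scope ring_scope.

(** Modulo 4 one has (1 + y)^2 = (1 - y)^2, so the denominator (-q;q)_m^2 of
    the m-th term of f^(3) may be replaced by (q;q)_m^2.  Modulo 2 one has
    1 + y^2 = (1 - y)^2, so the denominator (-q^2;q^2)_m of the m-th term of
    phi^(3) may be replaced by (q;q)_m^2 as well.  Both series therefore reduce
    to the sum over m of q^(m^2) / (q;q)_m^2, which by Durfee's identity is
    1 / (q;q)_oo, the generating function of p(n).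

    Only coefficients of index at most n matter, so the comparison takes place
    in the ring A = (Z/d)[X] / (X^(n+1)) with d = 4 or 2.  There X is nilpotent,
    every series becomes a finite sum, and the reduction [truncX] from the
    integer polynomials to A is a ring morphism.  Being an inverse in A
    determines an element, which identifies the geometric expansions in the two
    series with powers of [inv_qpoch], the inverse of (q;q)_m ([truncX_durfee]).

    Durfee's identity ([durfee_identity]) is proved algebraically for any
    nilpotent x.  Let D(a) be the sum over m of x^(m(m+a)) / ((x)_m (x)_(m+a)),
    the sum over Durfee rectangles with sides m and m + a.  Then
    D(a) - D(a+1) = - x^(a+1) (D(a+1) - D(a+2)) ([durfee_sum_rec]); iterating
    makes the difference divisible by every power of x, hence zero.  So
    D(0) = D(a), and for large a only the term m = 0 of D(a) survives, which is
    1 / (x)_a.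

    That the coefficients of 1 / (q;q)_n count partitions ([coef_inv_qpoch]) is
    Euler's argument: expanding the product of geometric series gives one
    monomial for each vector of multiplicities of the parts 1, ..., n
    ([npartE]). *)

(** * Inverse q-Pochhammer symbols *)

(** The product of the truncated geometric series of 1 / (1 - x^(i+1)) for
    i < m.  It inverts (x;x)_m as soon as x^N = 0, but makes sense for any x,
    so the same expression over the integer polynomials can be expanded and
    counted, and then be transported by a ring morphism. *)
Definition inv_qpoch (A : comNzRingType) (x : A) (N m : nat) : A :=
  \prod_(i < m) \sum_(k < N) (x ^+ i.+1) ^+ k.

Section InvPoch.
Variables (A : comNzRingType) (x : A) (N : nat).
Hypothesis xN : x ^+ N = 0.

Lemma inv_qpochS m : (1 - x ^+ m.+1) * inv_qpoch x N m.+1 = inv_qpoch x N m.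
Proof.
rewrite /inv_qpoch big_ord_recr /= mulrCA -opprB mulNr -subrX1 exprAC xN.
case: N xN => [/eqP|k _]; first by rewrite expr0 oner_eq0.
by rewrite expr0n /= sub0r opprK mulr1.
Qed.

Lemma qpoch_inv m : qpoch x x m * inv_qpoch x N m = 1.
Proof.
elim: m => [|m IHm]; first by rewrite /qpoch /inv_qpoch !big_ord0 mulr1.
by rewrite /qpoch big_ord_recr /= -/(qpoch x x m) -exprS -mulrA inv_qpochS.
Qed.
End InvPoch.

Lemma rmorph_qpoch (A B : comNzRingType) (h : {rmorphism A -> B}) a q m :
  h (qpoch a q m) = qpoch (h a) (h q) m.
Proof.
rewrite rmorph_prod; apply: eq_bigr => k _.
by rewrite rmorphB rmorph1 rmorphM rmorphXn.
Qed.

Lemma rmorph_inv_qpoch (A B : comNzRingType) (h : {rmorphism A -> B}) x N m :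
  h (inv_qpoch x N m) = inv_qpoch (h x) N m.
Proof.
rewrite rmorph_prod; apply: eq_bigr => i _; rewrite rmorph_sum.
by apply: eq_bigr => k _; rewrite !rmorphXn.
Qed.

(** * Durfee's identity in a ring with a nilpotent element *)

Section Durfee.
(* J m stands for 1 / (x;x)_m. *)
Variables (A : comNzRingType) (x : A) (N : nat) (J : nat -> A).
Hypotheses (xN : x ^+ N = 0) (J0 : J 0%N = 1).
Hypothesis JS : forall m, (1 - x ^+ m.+1) * J m.+1 = J m.

Lemma nilpotent_expr_ge k : (N <= k)%N -> x ^+ k = 0.
Proof. by move=> /subnKC <-; rewrite exprD xN mul0r. Qed.

Definition durfee_sum a := \sum_(m < N) x ^+ (m * (m + a)) * (J m * J (m + a)%N).

(** Termwise, with (x)_(m+a+1) as common denominator, D(a) - D(a+1) has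
    numerator x^(m(m+a)) ((1 - x^(m+a+1)) - x^m), which splits into
    1 - x^m and - x^(m+a+1).  The second part is - x^(a+1) times the term of
    D(a+1); the first cancels the last factor of (x)_m, and shifting m by one
    turns it into x^(a+1) times the term of D(a+2). *)
Lemma durfee_sum_rec a :
  durfee_sum a - durfee_sum a.+1
  = - x ^+ a.+1 * (durfee_sum a.+1 - durfee_sum a.+2).
Proof.
pose t b m := x ^+ (m * (m + b)) * (J m * J (m + b)%N).
pose s m := x ^+ (m * (m + a)) * ((1 - x ^+ m) * (J m * J (m + a).+1)).
have sS m : s m.+1 = x ^+ a.+1 * t a.+2 m.
  rewrite /s /t [X in _ * X]mulrA JS [RHS]mulrA -exprD.
  by congr (x ^+ _ * (_ * J _)); lia.
have tS m : t a m - t a.+1 m = s m - x ^+ a.+1 * t a.+1 m.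
  have -> : t a.+1 m = x ^+ (m * (m + a)) * x ^+ m * (J m * J (m + a).+1).
    by rewrite /t -exprD; congr (x ^+ _ * (_ * J _)); lia.
  by rewrite /t -[J (m + a)%N]JS /s -addnS exprD; ring.
have sN : \sum_(m < N) s m = x ^+ a.+1 * durfee_sum a.+2.
  have sum_s : \sum_(m < N.+1) s m = x ^+ a.+1 * durfee_sum a.+2.
    rewrite big_ord_recl [s _]/s subrr mul0r mulr0 add0r mulr_sumr.
    by apply: eq_bigr => m _; rewrite -sS.
  (* The shift leaves a boundary term of exponent N (N + a), zero by nilpotency. *)
  rewrite -sum_s big_ord_recr /= [s N]/s nilpotent_expr_ge ?mul0r ?addr0 //.
  by case: (N) => // k; rewrite -{1}[k.+1]muln1 leq_mul2l addSn.
rewrite /durfee_sum -sumrB (eq_bigr _ (fun (m : 'I_N) _ => tS m)) sumrB sN.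
by rewrite -mulr_sumr; rewrite /t -/(durfee_sum a.+1) mulNr mulrBr opprB.
Qed.

Lemma durfee_sum_const a : durfee_sum a = durfee_sum 0.
Proof.
(* Each use of the recurrence gains at least one factor x. *)
have divX k b : exists c, durfee_sum b - durfee_sum b.+1 = x ^+ k * c.
  elim: k b => [|k IHk] b.
    by exists (durfee_sum b - durfee_sum b.+1); rewrite mul1r.
  have [c Dc] := IHk b.+1; exists (- x ^+ b * c).
  by rewrite durfee_sum_rec Dc !exprS; ring.
elim: a => // a <-; have [c] := divX N a.
by rewrite xN mul0r => /eqP; rewrite subr_eq0 => /eqP.
Qed.

Lemma durfee_identity a :
  (0 < N <= a.+1)%N -> \sum_(m < N) x ^+ (m ^ 2) * J m ^+ 2 = J a.
Proof.
case/andP=> N0 Na; transitivity (durfee_sum 0).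
  by apply: eq_bigr => m _; rewrite addn0 mulnn expr2.
rewrite -(durfee_sum_const a) /durfee_sum.
rewrite (bigD1 (Ordinal N0)) //= mul0n mul1r J0 mul1r add0n.
rewrite big1 ?addr0 // => -[[|m] lt_mN] // _.
by rewrite nilpotent_expr_ge ?mul0r //= mulSn; lia.
Qed.
End Durfee.

(** * Reduction modulo d and X^N *)

Section Coef.
Variables (R : comNzRingType) (N : nat).

Definition truncX : {poly int} -> {poly %/ ('X^N : {poly R})} :=
  in_qpoly 'X^N \o map_poly intr.
HB.instance Definition _ := GRing.RMorphism.on truncX.

Lemma truncX_nil : (0 < N)%N -> truncX 'X ^+ N = 0.
Proof.
move=> N0; rewrite -rmorphXn /= /truncX /comp map_polyXn; apply/val_inj => /=.
rewrite mk_monic_Xn prednK // -Pdiv.RingMonic.take_poly_rmodp.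
by rewrite -[X in take_poly _ X]mul1r take_polyMXn_0.
Qed.

Lemma truncX_coef p q k : (k < N)%N -> truncX p = truncX q ->
  (p`_k)%:~R = (q`_k)%:~R :> R.
Proof.
move=> kN /(congr1 (fun r : {poly %/ 'X^N} => (r : {poly R})`_k)) /=.
rewrite !mk_monic_Xn prednK ?(leq_trans _ kN) // -!Pdiv.RingMonic.take_poly_rmodp.
by rewrite !coef_take_poly kN !coef_map.
Qed.
End Coef.

Lemma qpoly_natr_Zp d (h : {poly 'Z_d}) : (1 < d)%N -> d%:R = 0 :> {poly %/ h}.
Proof. by move=> d1; rewrite -(rmorph_nat (qpolyC h)) pchar_Zp // rmorph0. Qed.

Lemma Zp_intr_eqz (d : nat) (a b : int) : (1 < d)%N ->
  a%:~R = b%:~R :> 'Z_d -> (a = b %[mod d])%Z.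
Proof.
move=> d1.
have modR c : exists2 r : nat, (c %% d)%Z = r & (r < d)%N.
  exists `|(c %% d)%Z|%N; have := modz_ge0 c (d := d);
    have := ltz_pmod c (d := d); lia.
have E c r : (c %% d)%Z = Posz r -> c%:~R = r%:R :> 'Z_d.
  move=> cr; rewrite {1}(divz_eq c d) rmorphD rmorphM /= cr.
  by rewrite [d%:~R]pchar_Zp // mulr0 add0r.
have [[r ar rd] [r' br rd']] := (modR a, modR b).
rewrite (E _ _ ar) (E _ _ br) ar br => /(congr1 (fun z : 'Z_d => z : nat)).
by rewrite !val_Zp_nat // !modn_small // => ->.
Qed.

(** * The mock theta denominators *)

Lemma qpoch_sqr_char4 (A : comNzRingType) (x : A) m :
  4%:R = 0 :> A -> qpoch (- x) x m ^+ 2 = qpoch x x m ^+ 2.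
Proof.
move=> A4; rewrite /qpoch -!prodrXl; apply: eq_bigr => k _.
apply/eqP; rewrite -subr_eq0; apply/eqP; set y := _ ^+ k.
by transitivity (4%:R * (x * y)); [ring | rewrite A4 mul0r].
Qed.

Lemma qpoch_X2_char2 (A : comNzRingType) (x : A) m :
  2%:R = 0 :> A -> qpoch (- x ^+ 2) (x ^+ 2) m = qpoch x x m ^+ 2.
Proof.
move=> A2; rewrite /qpoch -prodrXl; apply: eq_bigr => k _.
rewrite exprAC; set y := _ ^+ k.
apply/eqP; rewrite -subr_eq0; apply/eqP.
by transitivity (2%:R * (x * y)); [ring | rewrite A2 mul0r].
Qed.

(** The product differs from 1 by the image of (1 - d)^N, a multiple of X^N. *)
Lemma truncX_geo (R : comNzRingType) N (d : {poly int}) : (0 < N)%N -> d`_0 = 1 ->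
  truncX R N d * truncX R N (\sum_(k < N) (1 - d) ^+ k) = 1.
Proof.
move=> N0 d0; rewrite -rmorphM.
have -> : d * \sum_(k < N) (1 - d) ^+ k = 1 - (1 - d) ^+ N.
  by rewrite -[in RHS]opprB subrX1 -mulNr opprB subKr.
have /factor_theorem[e ->] : root (1 - d) 0.
  by rewrite /root hornerD hornerN hornerC horner_coef0 d0 subrr.
rewrite subr0 exprMn rmorphB rmorph1 rmorphM [X in _ * X]rmorphXn.
by rewrite truncX_nil // mulr0 subr0.
Qed.

(** Modulo X^(n+1), 1 / (q;q)_oo is 1 / (q;q)_n.  So a series with terms
    X^(m^2) / d_m has the coefficient of index n of 1 / (q;q)_oo in R
    as soon as d_m reduces to (q;q)_m^2 over R; this is the form in which f^(3)
    and phi^(3) are treated together. *)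
Lemma truncX_durfee (R : comNzRingType) (n : nat) (d : nat -> {poly int}) :
  (forall m, (d m)`_0 = 1) ->
  (forall m, let x := truncX R n.+1 'X in truncX R n.+1 (d m) = qpoch x x m ^+ 2) ->
  (fps_sum (fun m => fps_frac 'X^(m ^ 2) (d m)) n)%:~R
    = ((inv_qpoch 'X n.+1 n : {poly int})`_n)%:~R :> R.
Proof.
move=> d0 dE; rewrite /fps_sum /fps_frac -coef_sum.
apply: (@truncX_coef R n.+1) => //; rewrite rmorph_inv_qpoch rmorph_sum /=.
set x := truncX R n.+1 'X; have xN : x ^+ n.+1 = 0 by apply: truncX_nil.
rewrite -(@durfee_identity _ x n.+1 (inv_qpoch x n.+1)) // ?leqnn //; first last.
- exact: inv_qpochS.
- exact: big_ord0.
apply: eq_bigr => m _; rewrite rmorphM rmorphXn; congr (_ * _).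
(* Both sides invert (x;x)_m^2. *)
have /(congr1 ( *%R (inv_qpoch x n.+1 m ^+ 2))) := truncX_geo R (ltn0Sn n) (d0 m).
by rewrite dE mulrA -exprMn [_ * qpoch _ _ _]mulrC qpoch_inv // expr1n mul1r mulr1.
Qed.

(** * Partitions and their multiplicities *)

Lemma sumn_count_mem n s : 0%N \notin s -> all (leq^~ n) s ->
  sumn s = (\sum_(i < n) i.+1 * count_mem i.+1 s)%N.
Proof.
elim: s => [|a s IHs] /=; first by rewrite big1 // => i _; rewrite muln0.
rewrite inE negb_or => /andP[a0 s0] /andP[an sn]; rewrite IHs //.
under [RHS]eq_bigr do rewrite mulnDr.
rewrite [RHS]big_split; congr (_ + _)%N.
have pn : (a.-1 < n)%N by lia.
rewrite (bigD1 (Ordinal pn)) //= big1 ?addn0 => [|i].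
  by rewrite prednK ?eqxx ?muln1 //; lia.
by rewrite -val_eqE /= => ?; case: eqP => [|_]; rewrite ?muln0 //; lia.
Qed.

(** Entry i is the multiplicity of the part i + 1; it is at most n because t has
    length at most n. *)
Definition multiplicities n (t : {bseq n of 'I_n.+1}) : {ffun 'I_n -> 'I_n.+1} :=
  [ffun i : 'I_n => inord (count_mem i.+1 (map val t))].

Lemma multiplicitiesE n (t : {bseq n of 'I_n.+1}) i :
  multiplicities t i = count_mem i.+1 (map val t) :> nat.
Proof.
rewrite ffunE inordK // ltnS (leq_trans (count_size _ _)) //.
by rewrite size_map size_bseq.
Qed.

Lemma map_val_leq n (t : {bseq n of 'I_n.+1}) : all (leq^~ n) (map val t).
Proof. by apply/allP => _ /mapP[i _ ->]; exact: (ltn_ord i). Qed.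

(** A partition is determined by its multiplicities, and any vector of
    multiplicities of total weight n comes from a partition of n. *)
Lemma npartE n : npart n =
  #|[set f : {ffun 'I_n -> 'I_n.+1} | (\sum_(i < n) i.+1 * f i)%N == n]|.
Proof.
rewrite /npart -(@card_in_imset _ _ (@multiplicities n)) => [|t u].
  congr #|pred_of_set _|; apply/setP => f; apply/imsetP/idP => [[t]|].
    rewrite inE => /and3P[_ t0 /eqP tn] ->; rewrite inE -[X in _ == X]tn.
    rewrite (sumn_count_mem t0 (map_val_leq t)).
    by under eq_bigr do rewrite multiplicitiesE.
  rewrite inE => /eqP fn.
  (* The preimage of f lists each part i + 1 exactly f i times, sorted. *)
  pose s := flatten [seq nseq (f i) i.+1 | i : 'I_n <- index_enum _].
  have cs (j : 'I_n) : count_mem j.+1 s = f j.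
    rewrite count_flatten sumnE !big_map /= (bigD1 j) //=.
    rewrite count_nseq /= eqxx mul1n big1 ?addn0 // => i ij.
    by rewrite count_nseq /= eqSS (inj_eq val_inj) (negPf ij) mul0n.
  have s_part : is_partition n (sort geq s).
    apply/and3P; split.
    - by apply: sort_sorted => a b; apply: leq_total.
    - rewrite mem_sort; apply/negP => /flatten_mapP[i _].
      by rewrite mem_nseq andbF.
    - rewrite (perm_sumn (permEl (perm_sort _ _))) sumn_flatten.
      rewrite sumnE !big_map -[X in _ == X]fn.
      by under eq_bigr do rewrite sumn_nseq.
  have [t ts] := is_partition_bseq s_part.
  exists t; first by rewrite inE ts.
  apply/ffunP => j; apply: val_inj; rewrite /= multiplicitiesE ts.
  by rewrite (permP (permEl (perm_sort _ _))) cs.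
rewrite !inE => /and3P[t_sorted t0 _] /and3P[u_sorted u0 _] tu.
apply/val_inj/(inj_map val_inj).
apply: (@sorted_eq _ geq) => //.
- by move=> a b c ba cb; apply: leq_trans cb ba.
- by move=> a b ?; apply/anti_leq; rewrite andbC.
(* Two sorted sequences are equal once they agree in every multiplicity. *)
apply/allP => a a_tu.
have a0 : (0 < a)%N.
  rewrite lt0n; apply: contraL a_tu => /eqP ->.
  by rewrite mem_cat negb_or t0.
have an : (a.-1 < n)%N.
  rewrite prednK //; move: a_tu; rewrite mem_cat.
  by case/orP => /(allP (map_val_leq _)).
have := congr1 (fun f : {ffun _} => nat_of_ord (f (Ordinal an))) tu.
by rewrite !multiplicitiesE /= prednK // => ->.
Qed.

(** Expanding the product picks a summand f i < n + 1 in each factor i, that is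
    the monomial whose exponent is the weight of the multiplicity vector f. *)
Lemma coef_inv_qpoch n : (inv_qpoch 'X n.+1 n : {poly int})`_n = Posz (npart n).
Proof.
rewrite npartE /inv_qpoch bigA_distr_bigA coef_sum -natz -sum1_card natr_sum.
rewrite [RHS]big_mkcond; apply: eq_bigr => f _ /=.
under eq_bigr do rewrite -exprM.
rewrite -expr_sum coefXn inE eq_sym.
by case: eqP.
Qed.

(** * The congruences *)

Theorem theorem4p1 (n : nat) :
  (f3 n = Posz (npart n) %[mod 4])%Z /\ (phi3 n = Posz (npart n) %[mod 2])%Z.
Proof.
split; apply: Zp_intr_eqz => //; rewrite -coef_inv_qpoch; apply: truncX_durfee.
- exact: f3_denom_coef0.
- move=> m x; rewrite rmorphXn rmorph_qpoch rmorphN.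
  exact/qpoch_sqr_char4/qpoly_natr_Zp.
- exact: phi3_denom_coef0.
- move=> m x; rewrite rmorph_qpoch rmorphN rmorphXn.
  exact/qpoch_X2_char2/qpoly_natr_Zp.
Qed.
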